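(* For every constant $\lambda$ with $0<\lambda<1$, the generalized work function algorithm $\mathrm{WFA}_\lambda$ is constant competitive for the generalized 2-server problem on arbitrary metric spaces $\mathbb{X},\mathbb{Y}$; that is, there are constants $c\geq1$ and $c_0$ (depending only on $\lambda$) such that for all metric spaces $\mathbb{X},\mathbb{Y}$, every origin and every finite request sequence $\rho$, the cost of $\mathrm{WFA}_\lambda$ is at most $c\cdot\mathrm{Opt}_\rho+c_0$.
   Context: Generalized 2-server problem: an $\mathbb{X}$-server moves in a (symmetric) metric space $(\mathbb{X},d^{\mathbb{X}})$ and a $\mathbb{Y}$-server in a metric space $(\mathbb{Y},d^{\mathbb{Y}})$, starting from a given origin $(\mathcal{O}^{\mathbb{X}},\mathcal{O}^{\mathbb{Y}})$. Requests $(x,y)\in\mathbb{X}\times\mathbb{Y}$ arrive online; a request is served by moving the $\mathbb{X}$-server to $x$ or the $\mathbb{Y}$-server to $y$, without knowledge of future requests; the cost is the total distance travelled by both servers. Equivalently, one server moves in $\mathcal{M}=\mathbb{X}\times\mathbb{Y}$ with metric $d((x_1,y_1),(x_2,y_2))=d^{\mathbb{X}}(x_1,x_2)+d^{\mathbb{Y}}(y_1,y_2)$, and request $(x,y)$ is the set $r(x,y)=(\{x\}\times\mathbb{Y})\cup(\mathbb{X}\times\{y\})$. $\mathrm{Opt}_\rho$ is the minimum cost of serving $\rho$. For $\sigma=r_1,\dots,r_n$, the work function $W_\sigma(s)$ is the minimum of $d(\mathcal{O},s_1)+\sum_{i=1}^{n-1}d(s_i,s_{i+1})+d(s_n,s)$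 over $s_i\in r_i$. $\mathrm{WFA}_\lambda$: if after serving $\sigma$ the server is at $s$ and request $r$ arrives, it moves to any $s'\in\mathrm{Argmin}_{t\in\mathcal{M}}\{W_{\sigma,r}(t)+\lambda d(s,t)\}$. An algorithm is $c$-competitive if there is a constant $c_0$ such that its cost on every instance is at most $c$ times the optimal cost plus $c_0$. *)

(* Defs.v *)
From HB Require Import structures.
From mathcomp Require Import all_boot all_order all_algebra.
From mathcomp Require Import all_classical all_reals all_analysis.
From mathcomp Require Import lra.

Set Implicit Arguments.
Unset Strict Implicit.
Unset Printing Implicit Defensive.

Import Order.TTheory GRing.Theory Num.Theory.

Local Open Scope classical_set_scope.
Local Open Scope ring_scope.

(* The sum metric on X * Y; the pseudometric structure that the library puts
   on a product is the maximum one and is not used here. *)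
Definition dist2 (R : realType) (X Y : metricType R) (s t : X * Y) : R :=
  mdist s.1 t.1 + mdist s.2 t.2.

Definition request_set (R : realType) (X Y : metricType R) (q : X * Y) :
    set (X * Y) :=
  ([set q.1] `*` [set: Y]) `|` ([set: X] `*` [set q.2]).

Fixpoint serves (R : realType) (X Y : metricType R) (rho ss : seq (X * Y)) :
    Prop :=
  match rho, ss with
  | [::], [::] => True
  | q :: rho', s :: ss' => request_set q s /\ serves rho' ss'
  | _, _ => False
  end.

Fixpoint path_cost (R : realType) (X Y : metricType R) (o : X * Y)
    (ss : seq (X * Y)) : R :=
  if ss is s :: ss' then dist2 o s + path_cost s ss' else 0.

(* The infima in [Opt] and [work_function] are minima, see [Opt_attained] and
   [work_function_attained]. *)
Definition Opt (R : realType) (X Y : metricType R) (o : X * Y)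
    (rho : seq (X * Y)) : R :=
  inf [set path_cost o ss | ss in serves rho].

Definition work_function (R : realType) (X Y : metricType R) (o : X * Y)
    (sigma : seq (X * Y)) (s : X * Y) : R :=
  inf [set path_cost o (rcons ss s) | ss in serves sigma].

Definition argmin (R : realType) (T : Type) (f : T -> R) : set T :=
  [set t | forall u, f t <= f u].

(* [WFA_run lambda o rho ss]: started at [o], the algorithm may occupy the
   successive positions [ss] on the requests [rho]; ties in the argmin are
   broken arbitrarily, so that [ss] is not determined by [rho]. *)
Inductive WFA_run (R : realType) (X Y : metricType R) (lambda : R)
    (o : X * Y) : seq (X * Y) -> seq (X * Y) -> Prop :=
  | WFA_start : WFA_run lambda o [::] [::]
  | WFA_step sigma ss r s' :
      WFA_run lambda o sigma ss ->
      argmin (fun t => work_function o (rcons sigma r) t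
                       + lambda * dist2 (last o ss) t) s' ->
      WFA_run lambda o (rcons sigma r) (rcons ss s').

Section Attainment.
Context {R : realType} {X Y : metricType R}.
Implicit Types (o s t q : X * Y) (rho ss : seq (X * Y)).

Lemma dist2_ge0 s t : 0 <= dist2 s t.
Proof. by rewrite addr_ge0// mdist_ge0. Qed.

Lemma dist2xx s : dist2 s s = 0.
Proof. by rewrite /dist2 !mdistxx addr0. Qed.

Lemma dist2C s t : dist2 s t = dist2 t s.
Proof. by rewrite /dist2 metric_sym (metric_sym s.2). Qed.

Lemma dist2_triangle t s u : dist2 s u <= dist2 s t + dist2 t u.
Proof. by rewrite /dist2 addrACA lerD// metric_triangle. Qed.

Lemma path_cost_ge0 o ss : 0 <= path_cost o ss.
Proof. by elim: ss o => //= s ss IH o; rewrite addr_ge0// dist2_ge0. Qed.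

Lemma path_cost_cat o ss ss' :
  path_cost o (ss ++ ss') = path_cost o ss + path_cost (last o ss) ss'.
Proof.
by elim: ss o => [|s ss IH] o /=; rewrite ?add0r// IH addrA.
Qed.

Lemma path_cost_rcons o ss s :
  path_cost o (rcons ss s) = path_cost o ss + dist2 (last o ss) s.
Proof. by rewrite -cats1 path_cost_cat /= addr0. Qed.

(* The schedules that move, at each request, a single server onto it. *)
Fixpoint lazy o rho : seq (seq (X * Y)) :=
  if rho is q :: rho' then
    [seq (q.1, o.2) :: ss | ss <- lazy (q.1, o.2) rho']
    ++ [seq (o.1, q.2) :: ss | ss <- lazy (o.1, q.2) rho']
  else [:: [::]].

Lemma lazy_neq0 o rho : lazy o rho != [::].
Proof.
by elim: rho o => //= q rho IH o; move: (IH (q.1, o.2)); case: (lazy _ _).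
Qed.

Lemma lazy_serves o rho ss : ss \in lazy o rho -> serves rho ss.
Proof.
elim: rho o ss => [|q rho IH] o ss /=; first by rewrite inE => /eqP ->.
rewrite mem_cat => /orP[] /mapP[ss' /IH ? ->] /=; split => //.
  by left.
by right.
Qed.

Lemma lazy_le o o' rho ss : serves rho ss ->
  forall u, (size u <= 1)%N -> exists2 ss', ss' \in lazy o rho
    & path_cost o (ss' ++ u) <= dist2 o o' + path_cost o' (ss ++ u).
Proof.
move=> + u u1; elim: rho o o' ss => [|q rho IH] o o' [|s ss] //=.
  move=> _; exists [::]; first by rewrite inE.
  case: u u1 => [|t [|//]] _ /=; first by rewrite addr0 dist2_ge0.
  by rewrite !addr0 dist2_triangle.
have tr := dist2_triangle o' o s.
move=> [[[/= sq _]|[_ /= sq]] /IH {}IH].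
- have [ss' ss'l le] := IH (q.1, o.2) s.
  exists ((q.1, o.2) :: ss') => /=; first by rewrite mem_cat map_f.
  rewrite addrA; apply: le_trans (lerD tr (lexx _)).
  apply: le_trans (lerD (lexx _) le) _.
  by rewrite addrA lerD// /dist2 /= sq !mdistxx addr0 add0r.
- have [ss' ss'l le] := IH (o.1, q.2) s.
  exists ((o.1, q.2) :: ss') => /=; first by rewrite mem_cat map_f// orbT.
  rewrite addrA; apply: le_trans (lerD tr (lexx _)).
  apply: le_trans (lerD (lexx _) le) _.
  by rewrite addrA lerD// /dist2 /= sq !mdistxx addr0 add0r addrC.
Qed.

Lemma seq_argmin (T : eqType) (f : T -> R) (l : seq T) : l != [::] ->
  exists2 x, x \in l & forall y, y \in l -> f x <= f y.
Proof.
elim: l => // a l IH _; have [->|/IH[x xl xP]] := eqVneq l [::].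
  by exists a => [|y]; rewrite inE// => /eqP ->.
have [ax|xa] := leP (f a) (f x).
  exists a => [|y]; rewrite inE ?eqxx// => /predU1P[->//|/xP].
  exact: le_trans.
exists x => [|y]; rewrite inE ?xl ?orbT// => /predU1P[->|/xP//].
exact: ltW.
Qed.

Lemma inf_min (A : set R) m : A m -> lbound A m -> inf A = m.
Proof.
move=> Am Al; apply/eqP; rewrite eq_le; apply/andP; split.
  by apply: ge_inf => //; exists m.
by apply: lb_le_inf => //; exists m.
Qed.

Lemma schedule_min o rho u : (size u <= 1)%N -> exists2 ss, ss \in lazy o rho
  & (forall ss', serves rho ss' ->
       path_cost o (ss ++ u) <= path_cost o (ss' ++ u)).
Proof.
move=> u1.
have [ss ssl ssP] :=
  seq_argmin (fun ss => path_cost o (ss ++ u)) (lazy_neq0 o rho).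
exists ss => // ss' /(lazy_le o o)/(_ u u1)[ss'' /ssP le1].
by rewrite dist2xx add0r; exact: le_trans.
Qed.

Lemma Opt_attained o rho : exists2 ss, serves rho ss
  & Opt o rho = path_cost o ss /\
    forall ss', serves rho ss' -> path_cost o ss <= path_cost o ss'.
Proof.
have [ss /lazy_serves ssS ssP] := @schedule_min o rho [::] isT.
have ssm ss' : serves rho ss' -> path_cost o ss <= path_cost o ss'.
  by move/ssP; rewrite !cats0.
exists ss => //; split=> //; apply: inf_min; first by exists ss.
by move=> _ [ss' /ssm ? <-].
Qed.

Lemma work_function_lazy o rho s : exists2 ss, ss \in lazy o rho
  & work_function o rho s = path_cost o (rcons ss s) /\
    forall ss', serves rho ss' ->
      path_cost o (rcons ss s) <= path_cost o (rcons ss' s).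
Proof.
have [ss ssl ssP] := @schedule_min o rho [:: s] isT.
have ssm ss' : serves rho ss' ->
    path_cost o (rcons ss s) <= path_cost o (rcons ss' s).
  by move/ssP; rewrite !cats1.
exists ss => //; split=> //; apply: inf_min.
  by exists ss => //; exact: lazy_serves ssl.
by move=> _ [ss' /ssm ? <-].
Qed.

Lemma work_function_attained o rho s : exists2 ss, serves rho ss
  & work_function o rho s = path_cost o (rcons ss s) /\
    forall ss', serves rho ss' ->
      path_cost o (rcons ss s) <= path_cost o (rcons ss' s).
Proof.
by have [ss /lazy_serves] := work_function_lazy o rho s; exists ss.
Qed.

Lemma argmin_work_neq0 (lambda : R) o rho s : 0 <= lambda <= 1 ->
  argmin (fun t => work_function o rho t + lambda * dist2 s t) !=set0.
Proof.
move=> /andP[l0 l1].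
have [ss ssl ssP] := seq_argmin
  (fun ss => path_cost o ss + lambda * dist2 s (last o ss)) (lazy_neq0 o rho).
exists (last o ss) => u /=.
have [ss1 ss1l [-> _]] := work_function_lazy o rho u.
have [ss2 _ [-> le2]] := work_function_lazy o rho (last o ss).
have := le2 _ (lazy_serves ssl); rewrite (path_cost_rcons o ss) dist2xx addr0.
move=> /lerD/(_ (lexx (lambda * dist2 s (last o ss)))) /le_trans; apply.
apply: le_trans (ssP _ ss1l) _.
rewrite path_cost_rcons -addrA lerD2l.
apply: (@le_trans _ _ (lambda * dist2 s u + lambda * dist2 u (last o ss1))).
  by rewrite -mulrDr ler_wpM2l// dist2_triangle.
rewrite [leLHS]addrC lerD2r (dist2C u).
by rewrite ler_piMl// dist2_ge0.
Qed.

Lemma WFA_run_exists (lambda : R) o rho : 0 <= lambda <= 1 ->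
  exists ss, WFA_run lambda o rho ss.
Proof.
move=> l01; elim/last_ind: rho => [|rho r [ss run]].
  by exists [::]; exact: WFA_start.
have [s' s'P] := argmin_work_neq0 o (rcons rho r) (last o ss) l01.
by exists (rcons ss s'); exact: WFA_step.
Qed.

Lemma serves_rcons rho r ss : serves (rcons rho r) ss ->
  exists ss' s, [/\ ss = rcons ss' s, serves rho ss' & request_set r s].
Proof.
elim: rho ss => [|q rho IH] [|s ss] //=.
  by case: ss => [|? ?] [] // rs _; exists [::], s.
by move=> [qs /IH[ss' [s' [-> ? ?]]]]; exists (s :: ss'), s'.
Qed.

Lemma rcons_serves rho r ss s : serves rho ss -> request_set r s ->
  serves (rcons rho r) (rcons ss s).
Proof. by elim: rho ss => [|q rho IH] [|t ss] //= [qt /IH]; split; auto. Qed.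

(* For lambda = 1 the argmin need not be contained in the request. *)
Lemma WFA_run_serves (lambda : R) o rho ss : 0 <= lambda < 1 ->
  WFA_run lambda o rho ss -> serves rho ss.
Proof.
move=> /andP[l0 l1]; elim=> // {}rho {}ss r s' _ IH s'P.
apply: rcons_serves => //.
have [ss1 ss1S [W1 _]] := work_function_attained o (rcons rho r) s'.
have [ss2 [t [ss1E _ rt]]] := serves_rcons ss1S.
have [ss3 _ [W3 /(_ _ ss1S) le3]] := work_function_attained o (rcons rho r) t.
suff : dist2 t s' <= 0.
  rewrite le_eqVlt ltNge dist2_ge0 orbF paddr_eq0 ?mdist_ge0//.
  move=> /andP[/eqP/mdist_positivity t1 /eqP/mdist_positivity t2].
  by have -> : s' = t by case: s' t1 t2 {s'P W1} => a b /= <- <-; case: (t).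
have tr := ler_wpM2l l0 (dist2_triangle s' (last o ss) t).
move: (s'P t); rewrite W3 W1 => le1.
move: le1 le3 tr; rewrite !path_cost_rcons ss1E last_rcons dist2xx addr0.
rewrite (dist2C s' t) => le1 le3 tr.
rewrite -(@pmulr_rle0 _ (1 - lambda)) ?subr_gt0// mulrBl mul1r; lra.
Qed.

End Attainment.

(* Main.v *)
Require Import Defs.
From mathcomp Require Import all_boot all_order all_algebra.
From mathcomp Require Import all_classical all_reals all_analysis.
From mathcomp Require Import ring lra zify.

(* The last request leaves its mark on the work function W_j: up to distance,
   W_j is determined by its values on the cross of r_j. The position s_j of
   the algorithm is a slack point, W_j s_j <= W_j t + lambda * d s_j t for all
   t, and its cost is controlled by the sum of delta_j, the distance from s_j
   to the cross of r_(j+1). Progress is measured by Phi_j, the minimum over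
   triples of points of the monotone functional [triple] of W_j; it is O(Opt),
   and it grows by Omega(delta) whenever the optimal triple has two points
   close together and there is a slack point at distance delta from it, now or
   earlier.

   Consider a maximal run of steps during which Phi grows by less than
   epsilon times the sum of the delta_j. The optimal triples then stay close
   to one column, say, and all requests of the run have nearly the same
   X-coordinate, since otherwise the triple would be squeezed into two
   clusters. A point off that column can only have a small work function value
   by following the rows of all requests of the run, so that slackness forces
   some s_i to be as far from the column as the whole cost of the run. This
   prevents the orientation from changing, and it bounds the cost of a run that
   is never paid for by a multiple of Opt. *)

Import Order.TTheory GRing.Theory Num.Theory.
Set Implicit Arguments.
Unset Strict Implicit.
Unset Printing Implicit Defensive.

Local Open Scope ring_scope.

(** * Pseudometrics, slack points and the functional on triples *)

Definition pseudometric (R : realType) (M : Type) (d : M -> M -> R) :=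
  [/\ forall p, d p p = 0, forall p q, d p q = d q p
    & forall p q r, d p r <= d p q + d q r].

Definition lipschitz1 (R : realType) (M : Type) (d : M -> M -> R)
    (W : M -> R) :=
  forall p q, W p <= W q + d p q.

(* Here [g] is [(1 - lambda) / 2]. *)
Definition slack (R : realType) (M : Type) (d : M -> M -> R) (g : R)
    (W : M -> R) (s : M) :=
  forall t, W s <= W t + (1 - 2 * g) * d s t.

(* The third point measures how far W drops below the two cones of slope
   [1 - g] at the first two points, whose weight [4 / g] makes the functional
   monotone in W. *)
Definition triple (R : realType) (M : Type) (d : M -> M -> R) (g : R)
    (W : M -> R) (p : M * M * M) : R :=
  let: (p1, p2, p3) := p in
  4 / g * (W p1 + W p2 - (1 - g) * d p1 p2) + W p3
  - Num.min (W p1 + (1 - g) * d p3 p1) (W p2 + (1 - g) * d p3 p2).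

Lemma pseudometric_ge0 (R : realType) (M : Type) (d : M -> M -> R) :
  pseudometric d -> forall p q, 0 <= d p q.
Proof.
move=> [d0 dC dT] p q; have := dT p q p; rewrite d0 (dC q p); lra.
Qed.

Lemma pseudometric_add (R : realType) (M : Type) (dX dY d : M -> M -> R) :
  pseudometric dX -> pseudometric dY ->
  (forall p q, d p q = dX p q + dY p q) -> pseudometric d.
Proof.
move=> [X0 XC XT] [Y0 YC YT] dE; split=> [p|p q|p q u]; rewrite !dE.
- by rewrite X0 Y0 addr0.
- by rewrite XC YC.
- by have := XT p q u; have := YT p q u; lra.
Qed.

Section Triple.
Context {R : realType} {M : Type} (d : M -> M -> R) (pd : pseudometric d).
Context (g : R) (g_gt0 : 0 < g) (g_lt : 2 * g < 1).

(** The distance between the first two points changes by at most [e1 + e2], at slope [1 - g], so a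
    fraction [g] of the drop in [W] survives; the weight [4 / g] makes it large enough to pay for
    the change of the minimum. At the third point the drop [e3] faces slope [1 - g] as well. *)
Lemma triple_proj (W W' : M -> R) (p1 p2 p3 q1 q2 q3 : M) (e1 e2 e3 : R) :
  d p1 q1 <= e1 -> d p2 q2 <= e2 -> d p3 q3 <= e3 ->
  W q1 + e1 <= W' p1 -> W q2 + e2 <= W' p2 -> W q3 + e3 <= W' p3 ->
  triple d g W (q1, q2, q3) + g * (e1 + e2 + e3)
    <= triple d g W' (p1, p2, p3).
Proof.
have [g0 g1] := (g_gt0, g_lt).
have d_ge0 := pseudometric_ge0 pd; have [d0 dC dT] := pd.
move=> le1 le2 le3 W1 W2 W3 /=.
have Ag : 4 / g * g = 4 :> R by field; rewrite gt_eqF.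
have A8 : 8 <= 4 / g by rewrite ler_pdivlMr//; lra.
move: (4 / g) Ag A8 => A Ag A8.
have T12 : d p1 p2 <= d q1 q2 + e1 + e2.
  by have := dT p1 q1 p2; have := dT q1 q2 p2; rewrite (dC q2 p2); lra.
have T31 : d p3 p1 <= d q3 q1 + e3 + e1.
  by have := dT p3 q3 p1; have := dT q3 q1 p1; rewrite (dC q1 p1); lra.
have T32 : d p3 p2 <= d q3 q2 + e3 + e2.
  by have := dT p3 q3 p2; have := dT q3 q2 p2; rewrite (dC q2 p2); lra.
have e1_ge0 := le_trans (d_ge0 _ _) le1.
have e2_ge0 := le_trans (d_ge0 _ _) le2.
have e3_ge0 := le_trans (d_ge0 _ _) le3.
(* One copy of each excess [W' p - W q - e] is kept aside: the minimum may rise by that much when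
   [W] becomes [W']. *)
have heavy : A * (W q1 + W q2 - (1 - g) * d q1 q2) + 4 * (e1 + e2)
    + (W' p1 - W q1 - e1) + (W' p2 - W q2 - e2)
    <= A * (W' p1 + W' p2 - (1 - g) * d p1 p2).
  have : (A - 1) * (W' p1 - W q1 - e1 + (W' p2 - W q2 - e2)) >= 0.
    by apply: mulr_ge0; lra.
  have : A * ((1 - g) * (d q1 q2 + e1 + e2 - d p1 p2)) >= 0.
    by apply: mulr_ge0; [lra|apply: mulr_ge0; lra].
  have : A * g * (e1 + e2) = 4 * (e1 + e2) by rewrite Ag.
  lra.
have S31 : (1 - g) * d p3 p1 <= (1 - g) * (d q3 q1 + e3 + e1).
  by apply: ler_wpM2l; lra.
have S32 : (1 - g) * d p3 p2 <= (1 - g) * (d q3 q2 + e3 + e2).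
  by apply: ler_wpM2l; lra.
have ge1 : g * e1 >= 0 by apply: mulr_ge0; lra.
have ge2 : g * e2 >= 0 by apply: mulr_ge0; lra.
have he1 : g * e1 <= e1 by rewrite ler_piMl//; lra.
have he2 : g * e2 <= e2 by rewrite ler_piMl//; lra.
set m' := Num.min (W' p1 + _) _.
have m1 : m' <= W' p1 + (1 - g) * d p3 p1 by rewrite ge_min lexx.
have m2 : m' <= W' p2 + (1 - g) * d p3 p2 by rewrite ge_min lexx orbT.
by case: (leP (W q1 + _)) => _; lra.
Qed.

(* If two of the three points almost coincide, one of them is redundant and
   moving it to the slack point [s] pays off. *)
Lemma triple_gain (W : M -> R) (s q1 q2 q3 : M) (delta eta : R) :
  lipschitz1 d W -> slack d g W s ->
  delta <= d s q1 -> delta <= d s q2 -> delta <= d s q3 -> 0 <= delta ->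
  [\/ d q1 q2 <= eta, d q3 q1 <= eta | d q3 q2 <= eta] ->
  exists t, triple d g W t <= triple d g W (q1, q2, q3)
                              - g * delta + 8 / g * eta.
Proof.
have [g0 g1] := (g_gt0, g_lt).
have d_ge0 := pseudometric_ge0 pd; have [d0 dC dT] := pd.
move=> Wl Ws h1 h2 h3 delta_ge0 near.
have Ag : 4 / g * g = 4 :> R by field; rewrite gt_eqF.
have A8 : 8 <= 4 / g by rewrite ler_pdivlMr//; lra.
have -> : 8 / g = 2 * (4 / g) :> R by field; rewrite gt_eqF.
move: near; rewrite /triple; move: (4 / g) Ag A8 => A Ag A8 near.
have gd1 : g * delta <= g * d s q1 by apply: ler_wpM2l; lra.
have gd2 : g * delta <= g * d s q2 by apply: ler_wpM2l; lra.
have s1 := Ws q1; have s2 := Ws q2.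
case: near => [near|near|near].
(* When [q1] and [q2] are close, [s] replaces [q2]: slope [1 - 2 * g] from slackness against weight
   [1 - g] gains [g] per unit, which [4 / g] turns into [4 * d s q2]; the minimum drops by at most
   [2 * d s q2]. *)
- exists (q1, s, q3) => /=.
  have eta_ge0 := le_trans (d_ge0 _ _) near.
  have T1 := dT q2 q1 s; rewrite (dC q2 q1) (dC q2 s) in T1.
  have heavy : A * (W q1 + W s - (1 - g) * d q1 s) <=
      A * (W q1 + W q2 - (1 - g) * d q1 q2) - 4 * d s q2 + 2 * A * eta.
    have : A * (W q2 + (1 - 2 * g) * d s q2 - W s) >= 0.
      by apply: mulr_ge0; lra.
    have : A * ((1 - g) * (d q1 s + d q1 q2 - d s q2)) >= 0.
      by apply: mulr_ge0; [lra|apply: mulr_ge0; lra].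
    have : A * ((1 - g) * (eta - d q1 q2)) >= 0.
      by apply: mulr_ge0; [lra|apply: mulr_ge0; lra].
    have : A * (g * eta) >= 0.
      by apply: mulr_ge0; [lra|apply: mulr_ge0; lra].
    have : A * g * d s q2 = 4 * d s q2 by rewrite Ag.
    lra.
  have T3 := dT q3 s q2.
  have S3 : (1 - g) * d q3 q2 <= (1 - g) * (d q3 s + d s q2).
    by apply: ler_wpM2l; lra.
  have W2 := Wl q2 s; rewrite (dC q2 s) in W2.
  have gs2 : g * d s q2 >= 0 by apply: mulr_ge0 => //; lra.
  have gle : g * d s q2 <= d s q2 by rewrite ler_piMl//; lra.
  set m := Num.min (W q1 + (1 - g) * d q3 q1) (W q2 + _).
  have m1 : m <= W q1 + (1 - g) * d q3 q1 by rewrite ge_min lexx.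
  have m2 : m <= W q2 + (1 - g) * d q3 q2 by rewrite ge_min lexx orbT.
  by case: (leP (W q1 + (1 - g) * d q3 q1) (W s + _)) => _; lra.
(* When [q3] is close to [q1], the part outside the heavy term is at least [- 2 * eta]; with [s] as
   third point, slackness makes it at most [- g * delta]. *)
- exists (q1, q2, s) => /=.
  have eta_ge0 := le_trans (d_ge0 _ _) near.
  have Aeta : 8 * eta <= A * eta by apply: ler_wpM2r.
  have W1 := Wl q1 q3; rewrite (dC q1 q3) in W1.
  have geta : (1 - g) * d q3 q1 <= d q3 q1.
    by apply: ler_piMl => //; lra.
  set m := Num.min (W q1 + (1 - g) * d q3 q1) (W q2 + _).
  have m1 : m <= W q1 + (1 - g) * d q3 q1 by rewrite ge_min lexx.
  by case: (leP (W q1 + (1 - g) * d s q1) (W q2 + _)) => _; lra.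
- exists (q1, q2, s) => /=.
  have eta_ge0 := le_trans (d_ge0 _ _) near.
  have Aeta : 8 * eta <= A * eta by apply: ler_wpM2r.
  have W1 := Wl q2 q3; rewrite (dC q2 q3) in W1.
  have geta : (1 - g) * d q3 q2 <= d q3 q2.
    by apply: ler_piMl => //; lra.
  set m := Num.min (W q1 + (1 - g) * d q3 q1) (W q2 + _).
  have m1 : m <= W q2 + (1 - g) * d q3 q2 by rewrite ge_min lexx orbT.
  by case: (leP (W q1 + (1 - g) * d s q1) (W q2 + _)) => _; lra.
Qed.

End Triple.

(** * Requests and work functions seen through two coordinate pseudometrics *)

Definition on_cross (R : realType) (M : Type) (dX dY : M -> M -> R)
    (r q : M) :=
  dX q r = 0 \/ dY q r = 0.

(* Only the two coordinate pseudometrics of the product are used, so that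
   exchanging the servers amounts to exchanging [dX] and [dY]. *)
Section Chain.
Context {R : realType} {M : Type} (dX dY d : M -> M -> R).
Context (pX : pseudometric dX) (pY : pseudometric dY).
Context (dE : forall p q, d p q = dX p q + dY p q).
Context (mix : forall p q, exists z, dX z p = 0 /\ dY z q = 0).
Context (g : R) (g_gt0 : 0 < g) (g_lt : 2 * g < 1).
Context (r : nat -> M) (W : nat -> M -> R).
Context (W_lip : forall j, lipschitz1 d (W j)).
Context (W_cross : forall j p,
  exists2 q, on_cross dX dY (r j) q & W j q + d p q <= W j p).
Context (W_mono : forall j p, W j p <= W j.+1 p).
Context (W_succ : forall j p, exists2 q, on_cross dX dY (r j.+1) q
  & W j q + d p q <= W j.+1 p).
Context (W_stay : forall j q, on_cross dX dY (r j.+1) q -> W j.+1 q <= W j q).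

Let X0 p : dX p p = 0. Proof. by case: pX. Qed.
Let XC p q : dX p q = dX q p. Proof. by case: pX. Qed.
Let XT p q u : dX p u <= dX p q + dX q u. Proof. by case: pX. Qed.
Let X_ge0 p q : 0 <= dX p q. Proof. exact: pseudometric_ge0. Qed.
Let Y0 p : dY p p = 0. Proof. by case: pY. Qed.
Let YC p q : dY p q = dY q p. Proof. by case: pY. Qed.
Let YT p q u : dY p u <= dY p q + dY q u. Proof. by case: pY. Qed.
Let Y_ge0 p q : 0 <= dY p q. Proof. exact: pseudometric_ge0. Qed.
Let pd : pseudometric d := pseudometric_add pX pY dE.

Lemma W_le_mono i j p : (i <= j)%N -> W i p <= W j p.
Proof.
move=> /subnK <-; elim: (j - i)%N => [|k IH]; first by rewrite add0n.
by rewrite addSn; exact: le_trans IH (W_mono _ _).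
Qed.

(** * Movement of the requests and histories of the work function *)

Definition drift j : R := \sum_(l < j) dX (r l) (r l.+1).
Definition rise j : R := \sum_(l < j) dY (r l) (r l.+1).

Lemma driftS j : drift j.+1 = drift j + dX (r j) (r j.+1).
Proof. by rewrite /drift big_ord_recr. Qed.

Lemma riseS j : rise j.+1 = rise j + dY (r j) (r j.+1).
Proof. by rewrite /rise big_ord_recr. Qed.

Lemma drift0 : drift 0 = 0. Proof. by rewrite /drift big_ord0. Qed.
Lemma rise0 : rise 0 = 0. Proof. by rewrite /rise big_ord0. Qed.

Lemma drift_le i j : (i <= j)%N -> drift i <= drift j.
Proof.
move=> /subnK <-; elim: (j - i)%N => [|k IH]; first by rewrite add0n.
by rewrite addSn driftS; have := X_ge0 (r (k + i)%N) (r (k + i)%N.+1); lra.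
Qed.

Lemma drift_ge0 j : 0 <= drift j.
Proof. by rewrite -drift0 drift_le. Qed.

Lemma dX_drift i j : (i <= j)%N -> dX (r i) (r j) <= drift j - drift i.
Proof.
move=> /subnK <-; elim: (j - i)%N => [|k IH].
  by rewrite add0n X0 subrr.
rewrite addSn driftS.
by have := XT (r i) (r (k + i)%N) (r (k + i)%N.+1); lra.
Qed.

Lemma dY_rise i j : (i <= j)%N -> dY (r i) (r j) <= rise j - rise i.
Proof.
move=> /subnK <-; elim: (j - i)%N => [|k IH].
  by rewrite add0n Y0 subrr.
rewrite addSn riseS.
by have := YT (r i) (r (k + i)%N) (r (k + i)%N.+1); lra.
Qed.

Lemma rise_le i j : (i <= j)%N -> rise i <= rise j.
Proof. by move=> ij; have := dY_rise ij; have := Y_ge0 (r i) (r j); lra. Qed.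

(* A server waiting in the column of request [k] can follow the columns. *)
Lemma column_work k l t : (k <= l)%N -> dX t (r k) = 0 ->
  W l t <= W k t + 2 * (drift l - drift k).
Proof.
move=> kl tk.
(* The witness [u] is [t] shifted horizontally onto the column of request [l]; returning from [u] to
   [t] accounts for the factor 2. *)
suff [u [ul ut Wu ut']] : exists u, [/\ dX u (r l) = 0, dY u t = 0,
    W l u <= W k t + (drift l - drift k) & dX u t <= drift l - drift k].
  by have := W_lip l t u; rewrite dE (XC t) (YC t); lra.
move: kl => /subnK <-; elim: (l - k)%N => [|i [u [ul ut Wu ut']]].
  by exists t; rewrite add0n X0 Y0 subrr addr0.
rewrite addSn driftS; set j := (i + k)%N in ul ut Wu ut' *.
have [z [zr zt]] := mix (r j.+1) t.
have zu : dX z u <= dX (r j) (r j.+1).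
  have := XT z (r j.+1) u; have := XT (r j.+1) (r j) u.
  by rewrite (XC (r j) u) (XC (r j.+1) (r j)); lra.
exists z; split=> //.
- have := W_stay (or_introl zr); have := W_lip j z u; rewrite dE.
  by have := YT z t u; rewrite (YC t u); lra.
- by have := XT z u t; lra.
Qed.

(* An optimal schedule ending on a row either has followed the rows of all
   requests since [k], or has left a column at some request [i]. *)
Lemma row_history k l p : (k <= l)%N -> dY p (r l) = 0 ->
  (exists2 t, dY t (r k) = 0
     & W k t + dX t p + (rise l - rise k) <= W l p)
  \/ exists i t, [/\ (k <= i < l)%N, dX t (r i) = 0 &
     W i t + dX t p + dY t (r i.+1) + (rise l - rise i.+1) <= W l p].
Proof.
move=> kl pl; have [n kn] : exists n, (n + k)%N = l by exists (l - k)%N; lia.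
elim: n k kl kn => [|n IH] k kl kn.
  left; exists p; first by rewrite -kn add0n in pl.
  by rewrite -kn add0n X0 subrr !addr0.
have [||[t tk Wt]|[i [t [ik ti Wt]]]] := IH k.+1; [lia|lia| |]; last first.
  by right; exists i, t; split=> //; lia.
(* The value at [t] comes from the cross of request [k]: its column ends the history with [i = k],
   its row prolongs it. *)
have [q [qk|qk] Wq] := W_cross k t.
  right; exists k, q; split=> //; first by lia.
  have := W_mono k t; have := XT q t p; have := YT q t (r k.+1).
  by move: Wq; rewrite dE (XC t) (YC t); lra.
left; exists q => //; have := W_mono k t; have := XT q t p.
have := YT (r k) q (r k.+1); have := YT q t (r k.+1).
by move: Wq Wt; rewrite riseS dE (XC t) (YC t) (YC (r k) q); lra.
Qed.

(** Provides the hypotheses of [triple_proj] between [W 0] and [W j]. When [Phi] grows little, [e]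
    is too small to reach [rise j], and [p] must be near the column. *)
Lemma near_column j p : on_cross dX dY (r j) p -> exists t e,
  [/\ W 0 t + e <= W j p, d p t <= e
    & dX p (r j) <= e + drift j \/ rise j <= e].
Proof.
move=> [pj|pj].
  exists p, 0; split; first by rewrite addr0; exact: W_le_mono.
    by rewrite dE X0 Y0 addr0.
  by left; rewrite pj add0r drift_ge0.
have [[t t0 Wt]|[i [t [ij ti Wt]]]] := row_history (leq0n j) pj.
  exists t, (dX t p + rise j); split; first by move: Wt; rewrite rise0; lra.
    have := YT p (r j) t; have := YT (r j) (r 0%N) t.
    have := dY_rise (leq0n j); rewrite rise0 dE (XC p) (YC (r j) (r 0%N)).
    by rewrite (YC (r 0%N) t); lra.
  by right; have := X_ge0 t p; lra.
have ij' : (i.+1 <= j)%N by lia.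
exists t, (dX t p + dY t (r i.+1) + (rise j - rise i.+1)); split.
- by have := @W_le_mono 0 i t isT; lra.
- have := YT p (r j) t; have := YT (r j) (r i.+1) t; have := dY_rise ij'.
  by rewrite dE (XC p) (YC (r j) (r i.+1)) (YC (r i.+1) t); lra.
- left; have := XT p t (r j); have := XT t (r i) (r j).
  have := @dX_drift i j; rewrite ltnW; last by lia.
  move=> /(_ isT); have := drift_ge0 i; have := Y_ge0 t (r i.+1).
  by have := rise_le ij'; rewrite (XC p t); lra.
Qed.

(** * Slack positions along a chain and their accumulated cost *)

Context (s : nat -> M) (N : nat).
Context (s_slack : forall j, (j < N)%N -> slack d g (W j) (s j)).
Context (s_cross : forall j, (j < N)%N -> on_cross dX dY (r j) (s j)).
Context (delta : nat -> R).
Context (delta_ge0 : forall j, 0 <= delta j).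
Context (deltaX : forall j, (j < N)%N -> delta j <= dX (s j) (r j.+1)).
Context (deltaY : forall j, (j < N)%N -> delta j <= dY (s j) (r j.+1)).

Definition spent j : R := \sum_(l < j) delta l.

Lemma spentS j : spent j.+1 = spent j + delta j.
Proof. by rewrite /spent big_ord_recr. Qed.

Lemma spent0 : spent 0 = 0. Proof. by rewrite /spent big_ord0. Qed.

Lemma delta_le j : (j < N)%N ->
  delta j <= dY (r j) (r j.+1) + dX (r j) (r j.+1).
Proof.
move=> jN; have := deltaX jN; have := deltaY jN.
have := XT (s j) (r j) (r j.+1); have := YT (s j) (r j) (r j.+1).
by have := X_ge0 (r j) (r j.+1); have := Y_ge0 (r j) (r j.+1);
   case: (s_cross jN) => ->; lra.
Qed.

Lemma spent_le i j : (i <= j <= N)%N ->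
  spent j - spent i <= rise j - rise i + (drift j - drift i).
Proof.
move=> /andP[/subnK <-]; elim: (j - i)%N => [|k IH kN].
  by rewrite add0n !subrr addr0.
move: (IH (ltnW kN)); rewrite addSn spentS riseS driftS.
by have := delta_le kN; lra.
Qed.

(* The term [drift j.-1] makes the induction go through: in the column case of
   [row_history] the drift of step [i] is charged twice. *)
Lemma spent_drift (B : R) j : (j <= N)%N ->
  (forall i, (i < j)%N -> dX (s i) (r i) <= B) -> 0 <= B ->
  spent j <= (1 / g + 2) * (drift j + drift j.-1) + (1 / g + 1) * B.
Proof.
move=> jN sB B_ge0; have [g0 g1] := (g_gt0, g_lt).
have [n jn] := ubnP j; elim: n j jn jN sB => // n IH [|l] ln lN sB.
  rewrite spent0 /= drift0 addr0 mulr0 add0r; apply: mulr_ge0 => //.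
  by apply: addr_ge0 => //; rewrite divr_ge0 ?ltW.
have G : 1 / g > 0 by rewrite divr_gt0.
have Gg : 1 / g * g = 1 by field; rewrite gt_eqF.
have Gg2 (u v : R) : g * u <= v -> u <= 1 / g * v.
  by move=> uv; have := ler_wpM2l (ltW G) uv; rewrite mulrA Gg (mul1r u).
have GV (u : R) : 0 <= u -> 0 <= 1 / g * u by apply: mulr_ge0; lra.
rewrite -pred_Sn spentS.
have Dl : delta l <= dX (s l) (r l) + (drift l.+1 - drift l).
  rewrite driftS; have := deltaX lN; have := XT (s l) (r l) (r l.+1); lra.
have Dge := drift_le (leqnSn l); have D_ge0 := drift_ge0 l.
have [colS|rowS] := s_cross lN.
  have : spent l <= (1 / g + 2) * (drift l + drift l.-1) + (1 / g + 1) * B.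
    by apply: IH; [lia|lia|move=> i il; apply: sB; lia].
  have Dp : drift l.-1 <= drift l by apply: drift_le; lia.
  have := GV _ (@drift_ge0 l); have : 1 / g * (drift l.+1 - drift l.-1) >= 0.
    by apply: GV; lra.
  by rewrite colS in Dl; lra.
have [[t t0 Wt]|[k [t [kl tk Wt]]]] := row_history (leq0n l) rowS.
  have sl := s_slack lN (r 0%N).
  have cw := @column_work 0 l (r 0%N) isT (X0 _).
  have wl := W_lip 0 (r 0%N) t.
  have x1 := XT (r 0%N) (s l) t; have x2 := XT (s l) (r l) (r 0%N).
  have x3 := @dX_drift 0 l isT; have y1 := @dY_rise 0 l isT.
  have y2 := YT (s l) (r l) (r 0%N).
  have sBl := sB l (ltnSn l).
  have tl := @spent_le 0 l; rewrite leq0n (ltnW lN) in tl.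
  have {}tl := tl isT.
  (* Slackness against [r 0]: waiting in that column costs only drift by [column_work], whereas the
     history of [s l] has paid the full rise. *)
  have YR : g * rise l <= B + 2 * drift l.
    move: sl cw wl x1 x2 x3 y1 y2 Wt.
    rewrite !dE (XC (r l)) (YC (r l)) (XC t) (XC (r 0%N) (s l)) rowS.
    rewrite (YC (r 0%N) t) t0 rise0 drift0 !subr0 !add0r addr0.
    set u := dX (s l) (r 0%N); set v := dY (s l) (r 0%N).
    move=> sl cw wl x1 x2 x3 y1 y2 Wt.
    have : (1 - 2 * g) * v <= (1 - 2 * g) * rise l.
      by apply: ler_wpM2l; lra.
    have : g * u >= 0 by exact: mulr_ge0 (ltW g0) (X_ge0 _ _).
    lra.
  move: tl; rewrite spent0 rise0 drift0 !subr0 => tl.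
  have := Gg2 _ _ YR.
  have := GV _ D_ge0; have : 1 / g * (drift l.+1 - drift l) >= 0.
    by apply: GV; lra.
  lra.
have kN : (k.+1 <= l)%N by lia.
have sl := s_slack lN t.
have cw := @column_work k l t _ tk; have {}cw := cw (ltnW kN).
have y1 := YT (s l) (r l) t; have y2 := YT (r l) (r k.+1) t.
have y3 := dY_rise kN; have x3 := dX_drift (ltnW kN).
have x1 := XT (s l) t (r l); have x2 := XT t (r k) (r l).
have tl := @spent_le k.+1 l; rewrite kN (ltnW lN) in tl.
have {}tl := tl isT.
have Dk := drift_le (leqnSn k); have Dkl := drift_le kN.
have Yk := rise_le kN.
(* Slackness against [t], the point where the history left a column: the cost after request [k] is
   again bounded by drift, and the induction hypothesis at [k.+1] covers the rest. *)
have YK : g * (dX t (s l) + (rise l - rise k.+1)) <= drift l - drift k.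
  move: sl cw y1 y2 y3 Wt.
  rewrite !dE (XC (s l) t) (YC (r l) (r k.+1)) rowS (YC (r k.+1) t).
  set u := dX t (s l); set v := dY (s l) t; set w := dY t (r k.+1).
  move=> sl cw y1 y2 y3 Wt.
  have : (1 - 2 * g) * v <= (1 - 2 * g) * (rise l - rise k.+1 + w).
    by apply: ler_wpM2l; lra.
  have : g * w >= 0 by apply: mulr_ge0; rewrite ?Y_ge0; lra.
  lra.
have := Gg2 _ _ YK.
have IHk := IH k.+1; rewrite -pred_Sn in IHk.
have {}IHk : spent k.+1 <=
    (1 / g + 2) * (drift k.+1 + drift k) + (1 / g + 1) * B.
  apply: IHk => [||i ik]; first exact: leq_ltn_trans kN ln.
    exact: leq_trans kN (ltnW lN).
  by apply: sB; exact: leq_trans ik (leq_trans kN (leqnSn l)).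
have : 1 / g * (drift l - drift k.+1) >= 0 by apply: GV; lra.
have : 1 / g * (drift l.+1 - drift l) >= 0 by apply: GV; lra.
by move: x1; rewrite (XC (s l) t); lra.
Qed.

(** Otherwise [spent_drift] applies with [B = g / 3 * spent j]; its [B] term then absorbs at most
    half of [g * spent j], leaving [g * spent j <= 8 * drift j]. *)
Lemma far_from_column j : (0 < j <= N)%N -> 16 * drift j < g * spent j ->
  exists2 i, (i < j)%N & g / 3 * spent j < dX (s i) (r i).
Proof.
move=> /andP[j0 jN] Dj; have [g0 g1] := (g_gt0, g_lt).
apply: contrapT => near.
have nearB i : (i < j)%N -> dX (s i) (r i) <= g / 3 * spent j.
  by move=> ij; rewrite leNgt; apply/negP => far; apply: near; exists i.
have D_ge0 := drift_ge0 j.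
have D_gt0 : 0 < g * spent j by lra.
have B_ge0 : 0 <= g / 3 * spent j by lra.
have := spent_drift jN nearB B_ge0.
have Dp := drift_le (leq_pred j).
have gG : g * (1 / g) = 1 by field; rewrite gt_eqF.
move=> /(ler_wpM2l (ltW g0)).
rewrite [g * (_ + _)]mulrDr !mulrA !mulrDr gG.
have : (1 + g * 2) * drift j.-1 <= 2 * drift j.
  apply: (@le_trans _ _ ((1 + g * 2) * drift j)).
    by apply: ler_wpM2l => //; lra.
  by apply: ler_wpM2r => //; lra.
have : (1 + g * 2) * drift j <= 2 * drift j by apply: ler_wpM2r => //; lra.
have : (1 + g * 1) * (g / 3 * spent j) <= 3 / 2 * (g / 3 * spent j).
  by apply: ler_wpM2r => //; lra.
lra.
Qed.

(** Pigeonhole; it supplies the close pair required by [triple_gain]. *)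
Lemma two_clusters (P Q q1 q2 q3 : M) (e : R) :
  d q1 P <= e \/ d q1 Q <= e -> d q2 P <= e \/ d q2 Q <= e ->
  d q3 P <= e \/ d q3 Q <= e ->
  [\/ d q1 q2 <= 2 * e, d q3 q1 <= 2 * e | d q3 q2 <= 2 * e].
Proof.
have [_ dC dT] := pd.
have close p q u : d p u <= e -> d q u <= e -> d p q <= 2 * e.
  by move=> pu qu; have := dT p u q; rewrite (dC u); lra.
move=> [h1|h1] [h2|h2] [h3|h3];
  by [apply: Or31; apply: close; eassumption
     |apply: Or32; apply: close; eassumption
     |apply: Or33; apply: close; eassumption].
Qed.

(** * The minimum of the functional and its growth *)

Context (Phi : nat -> R).
Context (Phi_le : forall j p, Phi j <= triple d g (W j) p).
Context (Phi_min : forall j, exists p, triple d g (W j) p <= Phi j).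

Lemma triple_mono i j p : (i <= j)%N ->
  triple d g (W i) p <= triple d g (W j) p.
Proof.
case: p => [[p1 p2] p3] ij; have [d0 _ _] := pd.
have := @triple_proj _ _ d pd g g_gt0 g_lt (W i) (W j) p1 p2 p3 p1 p2 p3 0 0 0.
by rewrite !d0 !addr0 mulr0 addr0; apply=> //; exact: W_le_mono.
Qed.

Lemma Phi_mono i j : (i <= j)%N -> Phi i <= Phi j.
Proof.
move=> ij; have [p pj] := Phi_min j.
exact: le_trans (Phi_le _ p) (le_trans (triple_mono p ij) pj).
Qed.

(** An optimal triple for [W j.+1] is projected by [W_succ] onto the new cross, then by [W_cross]
    onto the old one. By [triple_proj] every displacement is paid for, and the final value is still
    at least [Phi j]. *)
Lemma Phi_step j : exists q1 q2 q3 q1' q2' q3',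
  [/\ [/\ on_cross dX dY (r j.+1) q1, on_cross dX dY (r j.+1) q2
        & on_cross dX dY (r j.+1) q3],
      [/\ on_cross dX dY (r j) q1', on_cross dX dY (r j) q2'
        & on_cross dX dY (r j) q3'],
      triple d g (W j) (q1, q2, q3) <= Phi j.+1,
      triple d g (W j) (q1', q2', q3') <= Phi j.+1
    & [/\ g * d q1 q1' <= Phi j.+1 - Phi j, g * d q2 q2' <= Phi j.+1 - Phi j
        & g * d q3 q3' <= Phi j.+1 - Phi j]].
Proof.
have g0 := g_gt0; have g_ge0 := ltW g_gt0.
have d_ge0 := pseudometric_ge0 pd.
have [[[p1 p2] p3] pj] := Phi_min j.+1.
have [q1 q1r q1W] := W_succ j p1.
have [q2 q2r q2W] := W_succ j p2.
have [q3 q3r q3W] := W_succ j p3.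
have [q1' q1r' q1W'] := W_cross j q1.
have [q2' q2r' q2W'] := W_cross j q2.
have [q3' q3r' q3W'] := W_cross j q3.
have pq := triple_proj pd g_gt0 g_lt (lexx _) (lexx _) (lexx _) q1W q2W q3W.
have qq' :=
  triple_proj pd g_gt0 g_lt (lexx _) (lexx _) (lexx _) q1W' q2W' q3W'.
have q'j := Phi_le j (q1', q2', q3').
have e1 := mulr_ge0 g_ge0 (d_ge0 q1 q1').
have e2 := mulr_ge0 g_ge0 (d_ge0 q2 q2').
have e3 := mulr_ge0 g_ge0 (d_ge0 q3 q3').
have f1 := mulr_ge0 g_ge0 (d_ge0 p1 q1).
have f2 := mulr_ge0 g_ge0 (d_ge0 p2 q2).
have f3 := mulr_ge0 g_ge0 (d_ge0 p3 q3).
exists q1, q2, q3, q1', q2', q3'; split=> //; [lra|lra|].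
by split; lra.
Qed.

(** * Chains along which [Phi] grows little, with orientation fixed by the first position *)

Context (Phi_small : forall j, (0 < j <= N)%N ->
  Phi j - Phi 0 < g ^+ 4 / 400 * spent j).
Context (delta_small : forall j, (0 < j < N)%N -> delta j <= 2 * spent j).
Context (s0_row : dY (s 0%N) (r 0%N) = 0).

(** Otherwise the near-optimal triple lies close to the two corners [P] and [Q] where the crosses of
    [r 0] and [r 1] meet, and [triple_gain] with the slack point [s 0] produces a triple below
    [Phi 0]. *)
Lemma drift_step0 : (0 < N)%N ->
  g * dX (r 0%N) (r 1%N) <= Phi 1 - Phi 0.
Proof.
move=> N0; have [g0 g1] := (g_gt0, g_lt).
rewrite leNgt; apply/negP => driftN.
have [q1 [q2 [q3 [q1' [q2' [q3' [[c1 c2 c3] [c1' c2' c3'] trq _ [e1 e2 e3]]]]]]]]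
  := Phi_step 0.
have small : Phi 1 - Phi 0 < g ^+ 4 / 400 * delta 0%N.
  by have := @Phi_small 1 N0; rewrite spentS spent0 add0r.
have Phi_ge0 := @Phi_mono 0 1 isT.
have dY0 : delta 0%N <= dY (r 0%N) (r 1%N).
  by have := deltaY N0; have := YT (s 0%N) (r 0%N) (r 1%N);
     rewrite s0_row; lra.
have sq q : on_cross dX dY (r 1%N) q -> delta 0%N <= d (s 0%N) q.
  rewrite dE; have := deltaX N0; have := deltaY N0.
  have := X_ge0 (s 0%N) q; have := Y_ge0 (s 0%N) q.
  by have := XT (s 0%N) q (r 1%N); have := YT (s 0%N) q (r 1%N);
     move=> ? ? ? ? ? ? []; lra.
have [P [PX PY]] := mix (r 0%N) (r 1%N).
have [Q [QX QY]] := mix (r 1%N) (r 0%N).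
pose T := (Phi 1 - Phi 0) / g.
have gT : g * T = Phi 1 - Phi 0 by rewrite /T; field; rewrite gt_eqF.
have T_ge0 : 0 <= T by apply: divr_ge0; lra.
have gle (u v : R) : g * u <= g * v -> u <= v by rewrite ler_pM2l.
have gg : g * g <= 1 / 4 by nra.
have TS : T < g ^+ 2 * delta 0%N / 800.
  rewrite -(ltr_pM2l g0) gT.
  apply: lt_le_trans small _; rewrite !exprS expr0 !mulr1.
  by have : g * (g * (g * delta 0%N)) * (1 / 2 - g) >= 0;
     [rewrite !mulr_ge0 ?delta_ge0//; lra|lra].
have gdd : g ^+ 2 * delta 0%N <= delta 0%N.
  by apply: ler_piMl => //; rewrite expr2; lra.
(* A point of one cross close to a point of the other is near a corner: two columns contradict
   [driftN], two rows contradict [dY0]. *)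
have cluster q q' : on_cross dX dY (r 1%N) q -> on_cross dX dY (r 0%N) q' ->
    g * d q q' <= Phi 1 - Phi 0 -> d q P <= T \/ d q Q <= T.
  move=> + + e; have eX := X_ge0 q q'; have eY := Y_ge0 q q'.
  have {}e : d q q' <= T by apply: gle; lra.
  rewrite !dE in e *.
  have x1 := XT q (r 1%N) Q; have y1 := YT q (r 1%N) P.
  have x0 := XT q' (r 0%N) P; have y0 := YT q' (r 0%N) Q.
  have x2 := XT q q' P; have y2 := YT q q' Q.
  have x3 := XT (r 0%N) q' (r 1%N); have x4 := XT q' q (r 1%N).
  have y3 := YT (r 0%N) q' (r 1%N); have y4 := YT q' q (r 1%N).
  move: x1 x0 x3 x4 y1 y0 y3 y4.
  rewrite (XC (r 1%N) Q) (YC (r 1%N) P) (XC (r 0%N) P) (YC (r 0%N) Q).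
  rewrite (XC (r 0%N) q') (YC (r 0%N) q') (XC q' q) (YC q' q).
  rewrite PX PY QX QY => x1 x0 x3 x4 y1 y0 y3 y4.
  move=> [a1|a1] [a0|a0].
  - suff : g * dX (r 0%N) (r 1%N) <= g * T by lra.
    by apply: ler_wpM2l; lra.
  - by right; lra.
  - by left; lra.
  - by exfalso; lra.
have [] := @triple_gain _ _ d pd g g_gt0 g_lt (W 0) (s 0%N) q1 q2 q3
    (delta 0%N) (2 * T) (W_lip 0) (s_slack N0) (sq _ c1) (sq _ c2) (sq _ c3)
    (delta_ge0 0).
  exact: (two_clusters (cluster _ _ c1 c1' e1) (cluster _ _ c2 c2' e2)
                       (cluster _ _ c3 c3' e3)).
move=> t trt; have := Phi_le 0 t.
have g8 : g * (8 / g * (2 * T)) = 16 * T by field; rewrite gt_eqF.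
move=> Pt; have : g * (g * delta 0%N) <= g * (g * T + 8 / g * (2 * T)).
  by apply: ler_wpM2l; lra.
rewrite [g * (g * T + _)]mulrDr g8.
have : g * (g * T) <= 1 / 4 * T by rewrite mulrA ler_wpM2r.
by rewrite expr2 in TS gdd; lra.
Qed.

(** Same contradiction, but [s j] may be close to the triple. The triple is near the column of
    [r j], and the slack point is an earlier [s i] far from that column; the gain is then taken on
    [W i], below [Phi i]. *)
Lemma drift_stepS j : (0 < j)%N -> (j < N)%N ->
  g * drift j <= Phi j - Phi 0 ->
  g * dX (r j) (r j.+1) <= Phi j.+1 - Phi j.
Proof.
move=> j0 jN IH; have [g0 g1] := (g_gt0, g_lt).
have d_ge0 := pseudometric_ge0 pd.
rewrite leNgt; apply/negP => driftN.
have [q1 [q2 [q3 [q1' [q2' [q3' [[c1 c2 c3] [c1' c2' c3'] _ trq [e1 e2 e3]]]]]]]]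
  := Phi_step j.
have small := @Phi_small j.+1 jN.
have dsmall := @delta_small j; rewrite j0 jN in dsmall.
have {}dsmall := dsmall isT.
have Phi0j := @Phi_mono 0 j isT; have Phijj := Phi_mono (leqnSn j).
set Dl := spent j in dsmall *.
(* The factor 3 comes from [delta j <= 2 * spent j]. *)
have {}small : Phi j.+1 - Phi 0 < g ^+ 4 / 400 * (3 * Dl).
  apply: lt_le_trans small _; apply: ler_wpM2l.
    by have := exprn_ge0 4 (ltW g0); lra.
  by rewrite spentS -/Dl; lra.
have D_ge0 : 0 <= Dl by apply: sumr_ge0.
pose T := (Phi j.+1 - Phi 0) / g.
have gT : g * T = Phi j.+1 - Phi 0 by rewrite /T; field; rewrite gt_eqF.
have T_ge0 : 0 <= T by apply: divr_ge0; lra.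
have gle (u v : R) : g * u <= g * v -> u <= v by rewrite ler_pM2l.
have gg : g * g <= 1 / 4 by nra.
have TS : T < 3 / 400 * (g * (g * (g * Dl))).
  rewrite -(ltr_pM2l g0) gT; apply: lt_le_trans small _.
  by rewrite !exprS expr0 !mulr1; lra.
have k1 : g * (g * (g * Dl)) <= 1 / 4 * (g * Dl).
  by rewrite mulrA ler_wpM2r// mulr_ge0// ltW.
have k2 : g * Dl <= 1 / 2 * Dl by apply: ler_wpM2r => //; lra.
have DT : drift j <= T by apply: gle; lra.
have tl := @spent_le 0 j; rewrite leq0n (ltnW jN) in tl.
have {}tl := tl isT; rewrite spent0 rise0 drift0 !subr0 -/Dl in tl.
have [t1 [f1 [W1 d1 n1]]] := near_column c1'.
have [t2 [f2 [W2 d2 n2]]] := near_column c2'.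
have [t3 [f3 [W3 d3 n3]]] := near_column c3'.
(* The displacements down to [W 0] are charged to the growth of [Phi] since the start of the chain,
   which is why [T] is measured from [Phi 0]. *)
have [E1 E2 E3] : [/\ f1 <= T, f2 <= T & f3 <= T].
  have := triple_proj pd g_gt0 g_lt d1 d2 d3 W1 W2 W3.
  have := Phi_le 0 (t1, t2, t3).
  have := mulr_ge0 (ltW g0) (le_trans (d_ge0 _ _) d1).
  have := mulr_ge0 (ltW g0) (le_trans (d_ge0 _ _) d2).
  have := mulr_ge0 (ltW g0) (le_trans (d_ge0 _ _) d3).
  move: trq; move: (triple _ _ _ _) (triple _ _ _ _) => a b *.
  by split; apply: gle; lra.
(* The alternative [rise j <= f] fails: rise and drift would both be at most [T], too little to
   cover [spent j]. *)
have col q f : f <= T -> dX q (r j) <= f + drift j \/ rise j <= f ->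
    dX q (r j) <= 2 * T.
  by move=> fT [|] ?; [lra|exfalso; lra].
have {n1} n1 := col _ _ E1 n1; have {n2} n2 := col _ _ E2 n2.
have {n3} n3 := col _ _ E3 n3.
have [i ij far] : exists2 i, (i < j)%N & g / 3 * Dl < dX (s i) (r i).
  by apply: far_from_column; [rewrite j0 ltnW|rewrite -/Dl; lra].
have sq q : dX q (r j) <= 2 * T -> g / 3 * Dl - 3 * T <= d (s i) q.
  have := XT (s i) q (r i); have := XT q (r j) (r i).
  have := dX_drift (ltnW ij); have := drift_ge0 i; have := Y_ge0 (s i) q.
  by rewrite dE (XC (r j) (r i)); lra.
have [P [PX PY]] := mix (r j) (r j.+1).
have cluster q q' : on_cross dX dY (r j.+1) q -> on_cross dX dY (r j) q' ->
    g * d q q' <= Phi j.+1 - Phi j -> dX q' (r j) <= 2 * T ->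
    d q' P <= 2 * T \/ d q' (r j) <= 2 * T.
  move=> + + e n; have eX := X_ge0 q q'; have eY := Y_ge0 q q'.
  have {}e' : d q q' <= T by apply: gle; lra.
  rewrite !dE in e e' *.
  have x1 := XT q' (r j) P; have y1 := YT q' q P.
  have y2 := YT q (r j.+1) P.
  have x3 := XT (r j) q' (r j.+1); have x4 := XT q' q (r j.+1).
  move: x1 y1 y2 x3 x4.
  rewrite (XC (r j) P) (YC (r j.+1) P) (XC (r j) q') (XC q' q) (YC q' q).
  rewrite PX PY => x1 y1 y2 x3 x4.
  move=> [a1|a1] [a0|a0].
  - suff : g * dX (r j) (r j.+1) <= g * (dX q q' + dY q q') by lra.
    by apply: ler_wpM2l; lra.
  - by right; lra.
  - by left; lra.
  - by right; lra.
have iN := ltn_trans ij jN.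
have [] := @triple_gain _ _ d pd g g_gt0 g_lt (W i) (s i) q1' q2' q3'
    (g / 3 * Dl - 3 * T) (2 * (2 * T)) (W_lip i) (s_slack iN)
    (sq _ n1) (sq _ n2) (sq _ n3).
- by lra.
- exact: (two_clusters (cluster _ _ c1 c1' e1 n1) (cluster _ _ c2 c2' e2 n2)
                       (cluster _ _ c3 c3' e3 n3)).
move=> t trt; have := Phi_le i t; have := @Phi_mono 0 i isT.
have := triple_mono (q1', q2', q3') (ltnW ij).
have g8 : g * (8 / g * (2 * (2 * T))) = 32 * T by field; rewrite gt_eqF.
move=> m1 m2 m3.
have : g * (g * (g / 3 * Dl - 3 * T)) <= g * (g * T + 8 / g * (2 * (2 * T))).
  by apply: ler_wpM2l; lra.
rewrite [g * (g * T + _)]mulrDr g8.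
have : g * (g * T) <= 1 / 4 * T by rewrite mulrA ler_wpM2r.
lra.
Qed.

Lemma drift_Phi j : (j <= N)%N -> g * drift j <= Phi j - Phi 0.
Proof.
elim: j => [_|j IH jN]; first by rewrite drift0 mulr0 subrr.
have {}IH := IH (ltnW jN); rewrite driftS mulrDr.
suff : g * dX (r j) (r j.+1) <= Phi j.+1 - Phi j by lra.
case: j jN IH => [|j] jN IH; first exact: drift_step0.
exact: drift_stepS.
Qed.

(** The drift is negligible, so some [s i] is farther than [g / 3 * spent N] from its column. A
    cheap point [z'] on the last cross is near the column, unless the whole rise is at most [B],
    which bounds the cost directly. *)
Lemma chain_spent (o z : M) (B : R) : (0 < N)%N ->
  (forall j p, d o p <= W j p) -> W N z <= B -> g ^+ 2 * spent N <= 7 * B.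
Proof.
move=> N0 Wo zB; have [g0 g1] := (g_gt0, g_lt).
have d_ge0 := pseudometric_ge0 pd; have [_ dC dT] := pd.
have [z' cz zW] := W_cross N z.
have z'B : W N z' <= B by have := d_ge0 z z'; lra.
have B_ge0 : 0 <= B by have := Wo N z'; have := d_ge0 o z'; lra.
have Phi_ge0 := @Phi_mono 0 N isT.
have small := @Phi_small N; rewrite N0 leqnn in small; have {}small := small isT.
have DP := drift_Phi (leqnn N); have D_ge0 := drift_ge0 N.
set Dl := spent N in small *.
have Dl_ge0 : 0 <= Dl by apply: sumr_ge0.
have gg : g * g <= 1 / 4 by nra.
have DS : drift N < 1 / 400 * (g * (g * (g * Dl))).
  rewrite -(ltr_pM2l g0); apply: le_lt_trans DP _; apply: lt_le_trans small _.
  by rewrite !exprS expr0 !mulr1; lra.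
have k0 : g * Dl <= 1 / 2 * Dl by apply: ler_wpM2r => //; lra.
have k1 : g * (g * (g * Dl)) <= 1 / 4 * (g * Dl).
  by rewrite mulrA ler_wpM2r// mulr_ge0// ltW.
have k2 : g * (g * Dl) <= 1 / 4 * Dl by rewrite mulrA ler_wpM2r.
have tl := @spent_le 0 N; rewrite leq0n leqnn in tl.
have {}tl := tl isT; rewrite spent0 rise0 drift0 !subr0 -/Dl in tl.
have [t [e [We de]]] := near_column cz.
have eB : e <= B by have := Wo 0%N t; have := d_ge0 o t; lra.
rewrite expr2 -mulrA => -[near|near]; last by lra.
have [i iN far] : exists2 i, (i < N)%N & g / 3 * Dl < dX (s i) (r i).
  by apply: far_from_column; [rewrite N0 leqnn|rewrite -/Dl; lra].
have sl := s_slack iN z'; have os := Wo i (s i); have oz := Wo N z'.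
have mz := W_le_mono z' (ltnW iN).
have sz := dT (s i) o z'; rewrite (dC (s i) o) in sz.
(* Slackness of [s i] against [z'] keeps [s i] within [B / g] of the origin. *)
have osB : g * d o (s i) <= B.
  have : (1 - 2 * g) * d (s i) z' <= (1 - 2 * g) * (d o (s i) + B).
    by apply: ler_wpM2l; lra.
  by have : g * B >= 0; [apply: mulr_ge0; lra|lra].
have x1 := XT (s i) z' (r i); have x2 := XT z' (r N) (r i).
have x3 := dX_drift (ltnW iN); rewrite (XC (r i)) in x3.
have D_gei := drift_ge0 i; have y1 := Y_ge0 (s i) z'.
have dz := dE (s i) z'.
have : g * (g / 3 * Dl) <= g * (d o (s i) + B + (B + drift N) + drift N).
  by apply: ler_wpM2l; lra.
have gB : g * B <= 1 / 2 * B by apply: ler_wpM2r => //; lra.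
have gD : g * drift N <= 1 / 2 * drift N by apply: ler_wpM2r => //; lra.
have k3 : g * (g * (g * Dl)) <= 1 / 2 * (g * (g * Dl)).
  by apply: ler_wpM2r; [rewrite !mulr_ge0// ltW|lra].
lra.
Qed.

End Chain.

(** * Cutting the request sequence into paid stretches and one unpaid chain *)

Section ExtendedCost.
Context {R : realType} {M : Type} (dX dY d : M -> M -> R).
Context (pX : pseudometric dX) (pY : pseudometric dY).
Context (dE : forall p q, d p q = dX p q + dY p q).
Context (mix : forall p q, exists z, dX z p = 0 /\ dY z q = 0).
Context (g : R) (g_gt0 : 0 < g) (g_lt : 2 * g < 1).
Context (r : nat -> M) (W : nat -> M -> R).
Context (W_lip : forall j, lipschitz1 d (W j)).
Context (W_cross : forall j p,
  exists2 q, on_cross dX dY (r j) q & W j q + d p q <= W j p).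
Context (W_mono : forall j p, W j p <= W j.+1 p).
Context (W_succ : forall j p, exists2 q, on_cross dX dY (r j.+1) q
  & W j q + d p q <= W j.+1 p).
Context (W_stay : forall j q, on_cross dX dY (r j.+1) q -> W j.+1 q <= W j q).
Context (s : nat -> M) (n : nat).
Context (s_slack : forall j, (j < n)%N -> slack d g (W j) (s j)).
Context (s_cross : forall j, (j < n)%N -> on_cross dX dY (r j) (s j)).
Context (delta : nat -> R).
Context (delta_ge0 : forall j, 0 <= delta j).
Context (deltaX : forall j, (j < n)%N -> delta j <= dX (s j) (r j.+1)).
Context (deltaY : forall j, (j < n)%N -> delta j <= dY (s j) (r j.+1)).
Context (Phi : nat -> R).
Context (Phi_le : forall j p, Phi j <= triple d g (W j) p).
Context (Phi_min : forall j, exists p, triple d g (W j) p <= Phi j).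
Context (o z : M) (B : R).
Context (W_origin : forall j p, d o p <= W j p) (zB : W n z <= B).

Lemma on_crossC u q : on_cross dX dY u q -> on_cross dY dX u q.
Proof. by move=> [] ?; [right|left]. Qed.

Lemma spent_shift m j :
  spent (fun i => delta (m + i)) j = spent delta (m + j) - spent delta m.
Proof.
elim: j => [|j IH]; first by rewrite spent0 addn0 subrr.
by rewrite spentS IH addnS spentS addrAC.
Qed.

Lemma spent_mono i j : (i <= j)%N -> spent delta i <= spent delta j.
Proof.
move=> /subnK <-; elim: (j - i)%N => [|k IH]; first by rewrite add0n.
by rewrite addSn spentS; have := delta_ge0 (k + i)%N; lra.
Qed.

(** Indices are shifted by [m], and the two coordinates are exchanged when [s m] lies in the column
    of [r m], so that the chain starts on a row. *)
Lemma chain_spent_from m : (m < n)%N ->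
  (forall j, (m < j <= n)%N ->
     Phi j - Phi m < g ^+ 4 / 400 * (spent delta j - spent delta m)) ->
  (forall j, (m < j < n)%N -> delta j <= 2 * (spent delta j - spent delta m)) ->
  g ^+ 2 * (spent delta n - spent delta m) <= 7 * B.
Proof.
move=> mn small dsmall.
have [k nE] : exists k, n = (m + k)%N by exists (n - m)%N; lia.
have k0 : (0 < k)%N by lia.
have lt j : (j < k)%N -> (m + j < n)%N by lia.
have shift_small j : (0 < j <= k)%N -> Phi (m + j) - Phi (m + 0)
    < g ^+ 4 / 400 * spent (fun i => delta (m + i)) j.
  by move=> jk; rewrite spent_shift addn0; apply: small; lia.
have shift_dsmall j : (0 < j < k)%N ->
    delta (m + j) <= 2 * spent (fun i => delta (m + i)) j.
  by move=> jk; rewrite spent_shift; apply: dsmall; lia.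
have zk : W (m + k) z <= B by rewrite -nE.
rewrite nE -spent_shift.
have step j : (m + j.+1)%N = (m + j).+1 by rewrite addnS.
case: (s_cross mn) => ms.
- apply: (@chain_spent _ _ dY dX d pY pX _ _ g g_gt0 g_lt
    (fun i => r (m + i)) (fun i => W (m + i)) _ _ _ _ _
    (fun i => s (m + i)) k _ _ (fun i => delta (m + i)) _ _ _
    (fun i => Phi (m + i)) _ _ _ _ _ o z B) => //.
  + by move=> p q; rewrite dE addrC.
  + by move=> p q; have [u [? ?]] := mix q p; exists u.
  + by move=> j p; have [q /on_crossC ? ?] := W_cross (m + j) p; exists q.
  + by move=> j p; rewrite step.
  + move=> j p; rewrite step.
    by have [q /on_crossC ? ?] := W_succ (m + j) p; exists q.
  + move=> j q; rewrite step => -[] ?; apply: W_stay; by [right|left].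
  + by move=> j /lt; exact: s_slack.
  + by move=> j /lt/s_cross/on_crossC.
  + by move=> j /lt/deltaY; rewrite step.
  + by move=> j /lt/deltaX; rewrite step.
  + by rewrite addn0.
- apply: (@chain_spent _ _ dX dY d pX pY _ _ g g_gt0 g_lt
    (fun i => r (m + i)) (fun i => W (m + i)) _ _ _ _ _
    (fun i => s (m + i)) k _ _ (fun i => delta (m + i)) _ _ _
    (fun i => Phi (m + i)) _ _ _ _ _ o z B) => //.
  + by move=> j p; rewrite step.
  + by move=> j p; rewrite step.
  + by move=> j q; rewrite step; exact: W_stay.
  + by move=> j /lt; exact: s_slack.
  + by move=> j /lt/s_cross.
  + by move=> j /lt/deltaX; rewrite step.
  + by move=> j /lt/deltaY; rewrite step.
  + by rewrite addn0.
Qed.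

(** A stretch whose cost is paid by the growth of [Phi] is cut off and the induction restarts after
    it. If no such stretch starts at [m], the remainder is bounded by [chain_spent_from]. *)
Lemma spent_Phi m : (m <= n)%N -> spent delta n - spent delta m <=
  (g ^+ 4 / 800)^-1 * (Phi n - Phi m) + 14 / g ^+ 2 * B.
Proof.
have g0 := g_gt0.
(* Starting at the last dominant index may halve the cost of a stretch, hence a threshold half as
   large as in [chain_spent_from]. *)
have E4 : g ^+ 4 / 400 = 2 * (g ^+ 4 / 800) by lra.
have E_gt0 : 0 < g ^+ 4 / 800 by have := exprn_gt0 4 g0; lra.
have G2 : 0 < g ^+ 2 by rewrite exprn_gt0.
have B_ge0 : 0 <= B.
  have pd := pseudometric_add pX pY dE.
  apply: le_trans (le_trans _ zB); last exact: W_origin.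
  exact: pseudometric_ge0.
have B'_ge0 : 0 <= 14 / g ^+ 2 * B.
  apply: mulr_ge0 => //; have : 0 < (g ^+ 2)^-1 by rewrite invr_gt0.
  by lra.
have small_total i : (i < n)%N -> (forall j, (i < j <= n)%N ->
     Phi j - Phi i < 2 * (g ^+ 4 / 800) * (spent delta j - spent delta i)) ->
  (forall j, (i < j < n)%N -> delta j <= 2 * (spent delta j - spent delta i)) ->
  g ^+ 2 * (spent delta n - spent delta i) <= 7 * B.
  by rewrite -E4; exact: chain_spent_from.
move: (g ^+ 4 / 800) E_gt0 small_total {E4} => E E_gt0 small_total.
have [k mk] := ubnP (n - m); elim: k m mk => // k IH m mk mn.
have [mn'|mn'] := eqVneq m n; first by rewrite mn' !subrr mulr0 add0r.
have {mn'}mn' : (m < n)%N by rewrite ltn_neqAle mn' mn.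
have [[j /andP[mj jn] paid]|unpaid] := pselect (exists2 j, (m < j <= n)%N
    & E * (spent delta j - spent delta m) <= Phi j - Phi m).
  have jk : (n - j < k)%N by apply: leq_trans (ltn_sub2l mn' mj) _.
  have {}IH := IH j jk jn.
  have Ei : 0 <= E^-1 by rewrite invr_ge0 ltW.
  by have := ler_wpM2l Ei paid; rewrite mulKf ?gt_eqF//; lra.
have {}unpaid j : (m < j <= n)%N ->
    Phi j - Phi m < E * (spent delta j - spent delta m).
  by move=> mj; rewrite ltNge; apply/negP => paid; apply: unpaid; exists j.
(* The last index whose cost exceeds everything before it carries at least
   half of the total, and no later cost is dominant. *)
pose dominant i := [&& (m <= i)%N, (i < n)%N
  & spent delta i - spent delta m <= delta i].
have exD : exists i, dominant i.
  by exists m; rewrite /dominant leqnn mn' subrr delta_ge0.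
have ubD i : dominant i -> (i <= n)%N by case/and3P => _ /ltnW.
have [m' /and3P[mm' m'n dom] max] := ex_maxnP exD ubD.
have Pm : Phi m <= Phi m'.
  exact: (Phi_mono pX pY dE g_gt0 g_lt W_mono Phi_le Phi_min mm').
have half j : (m' < j)%N ->
    spent delta j - spent delta m <= 2 * (spent delta j - spent delta m').
  by move=> m'j; have := spent_mono m'j; rewrite spentS; lra.
have : g ^+ 2 * (spent delta n - spent delta m') <= 7 * B.
  apply: small_total => // j /andP[m'j jn].
    have mj : (m < j <= n)%N by rewrite jn (leq_ltn_trans mm' m'j).
    have := unpaid _ mj; have := half j m'j.
    set u := spent delta j - spent delta m.
    set v := spent delta j - spent delta m'.
    move=> uv lt.
    have : E * u <= E * (2 * v) by apply: ler_wpM2l; lra.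
    lra.
  have : ~~ dominant j by apply/negP => /max; rewrite leqNgt m'j.
  rewrite /dominant jn (leq_trans mm' (ltnW m'j)) /= -ltNge.
  by have := half j m'j; lra.
have := half n m'n.
have Pn : Phi m <= Phi n.
  exact: (Phi_mono pX pY dE g_gt0 g_lt W_mono Phi_le Phi_min mn).
have Pge : 0 <= E^-1 * (Phi n - Phi m).
  by apply: mulr_ge0; [rewrite invr_ge0 ltW|lra].
have Gp : 0 <= 2 / g ^+ 2 by rewrite divr_ge0// ltW.
move=> h /(ler_wpM2l Gp).
have -> : 2 / g ^+ 2 * (g ^+ 2 * (spent delta n - spent delta m'))
    = 2 * (spent delta n - spent delta m') by field; rewrite gt_eqF.
have -> : 2 / g ^+ 2 * (7 * B) = 14 / g ^+ 2 * B by ring.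
lra.
Qed.

Lemma spent_bound :
  spent delta n <= ((g ^+ 4 / 800)^-1 * (8 / g) + 14 / g ^+ 2) * B.
Proof.
have g0 := g_gt0.
have pd := pseudometric_add pX pY dE.
have [d0 dC dT] := pd; have d_ge0 := pseudometric_ge0 pd.
(* Projection of an optimal triple onto [(o, o, o)] with the zero function below, where the
   functional vanishes. *)
have Phi0 : 0 <= Phi 0.
  have [[[p1 p2] p3] pP] := Phi_min 0; apply: le_trans pP.
  have Wo p : 0 + d p o <= W 0 p by rewrite add0r dC.
  have := @triple_proj _ _ d pd g g_gt0 g_lt (fun=> 0) (W 0) p1 p2 p3 o o o
    _ _ _ (lexx _) (lexx _) (lexx _) (Wo p1) (Wo p2) (Wo p3).
  apply: le_trans; rewrite /triple d0 !mulr0 !addr0 subr0 mulr0 minxx !add0r.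
  by rewrite oppr0 add0r; apply: mulr_ge0; [exact: ltW|rewrite !addr_ge0].
have Phin : Phi n <= 8 / g * B.
  apply: le_trans (Phi_le n (z, z, z)) _.
  rewrite /triple d0 !mulr0 !addr0 subr0 minxx addrK.
  have -> : 4 / g * (W n z + W n z) = 8 / g * W n z by ring.
  by apply: ler_wpM2l => //; rewrite divr_ge0// ltW.
have := @spent_Phi 0 isT; rewrite spent0 subr0 => /le_trans; apply.
rewrite [leRHS]mulrDl -[X in _ <= X + _]mulrA lerD2r; apply: ler_wpM2l; last by lra.
by rewrite invr_ge0; have := exprn_gt0 4 g0; lra.
Qed.

End ExtendedCost.

(** * Work functions and runs of the algorithm as instances of the abstract setting *)

Section WorkFunction.
Context {R : realType} {X Y : metricType R}.
Implicit Types (o p q s t : X * Y) (rho ss : seq (X * Y)).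

Definition dist_fst p q : R := mdist p.1 q.1.
Definition dist_snd p q : R := mdist p.2 q.2.

Lemma dist_fst_pseudometric : pseudometric dist_fst.
Proof.
split=> [p|p q|p q t]; [exact: mdistxx|exact: metric_sym|].
exact: metric_triangle.
Qed.

Lemma dist_snd_pseudometric : pseudometric dist_snd.
Proof.
split=> [p|p q|p q t]; [exact: mdistxx|exact: metric_sym|].
exact: metric_triangle.
Qed.

Lemma dist2_pseudometric : pseudometric (@dist2 R X Y).
Proof.
split=> [p|p q|p q t]; [exact: dist2xx|exact: dist2C|exact: dist2_triangle].
Qed.

Lemma request_setP q t :
  request_set q t <-> on_cross dist_fst dist_snd q t.
Proof.
split=> [[[/= tq _]|[_ /= tq]]|[]].
- by left; rewrite /dist_fst tq mdistxx.
- by right; rewrite /dist_snd tq mdistxx.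
- by move=> /mdist_positivity tq; left.
- by move=> /mdist_positivity tq; right.
Qed.

Lemma work_function_lipschitz o rho : lipschitz1 (@dist2 R X Y)
  (work_function o rho).
Proof.
move=> p q; have [ss ssS [-> _]] := work_function_attained o rho q.
have [ss' _ [-> /(_ _ ssS)]] := work_function_attained o rho p.
rewrite !path_cost_rcons (dist2C p q).
by have := dist2_triangle q (last o ss) p; lra.
Qed.

Lemma work_function_nil o p : work_function o [::] p = dist2 o p.
Proof.
have [[|? ?] //= _ [-> _]] := work_function_attained o [::] p.
by rewrite addr0.
Qed.

Lemma work_function_rcons_ge o rho q p : exists2 t, request_set q t
  & work_function o rho t + dist2 p t <= work_function o (rcons rho q) p.
Proof.
have [ss ssS [-> _]] := work_function_attained o (rcons rho q) p.
have [ss' [t [-> ss'S qt]]] := serves_rcons ssS.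
exists t => //; rewrite path_cost_rcons last_rcons (dist2C p t) lerD2r.
by have [ss1 _ [-> /(_ _ ss'S)]] := work_function_attained o rho t.
Qed.

Lemma work_function_rcons_le o rho q t : request_set q t ->
  work_function o (rcons rho q) t <= work_function o rho t.
Proof.
move=> qt; have [ss ssS [-> _]] := work_function_attained o rho t.
have [ss' _ [-> /(_ _ (rcons_serves ssS qt))]] :=
  work_function_attained o (rcons rho q) t.
by rewrite (path_cost_rcons o (rcons ss t)) last_rcons dist2xx addr0.
Qed.

Lemma dist2_work_function o rho p : dist2 o p <= work_function o rho p.
Proof.
have [ss _ [-> _]] := work_function_attained o rho p.
elim: ss o => [|s ss IH] o /=; first by rewrite addr0.
by have := dist2_triangle s o p; have := IH s; lra.
Qed.

(** Every value of the work function is realized through the endpoint of one of finitely many lazy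
    schedules; by [triple_proj], moving to such endpoints never increases the functional. *)
Lemma triple_attained (g : R) o rho : 0 < g -> 2 * g < 1 ->
  exists a, forall b, triple (@dist2 R X Y) g (work_function o rho) a
                      <= triple (@dist2 R X Y) g (work_function o rho) b.
Proof.
move=> g0 g1; pose E := [seq last o ss | ss <- lazy o rho].
have EP p : exists2 e, e \in E
    & work_function o rho e + dist2 p e <= work_function o rho p.
  have [ss ssl [-> _]] := work_function_lazy o rho p.
  exists (last o ss); first exact: map_f.
  have [ss' _ [-> /(_ _ (lazy_serves ssl))]] :=
    work_function_attained o rho (last o ss).
  by rewrite !path_cost_rcons dist2xx (dist2C p); lra.
pose L := [seq (ab, c) | ab <- [seq (a, b) | a <- E, b <- E], c <- E].
have LP a b c : a \in E -> b \in E -> c \in E -> (a, b, c) \in L.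
  by move=> aE bE cE; rewrite allpairs_f// allpairs_f.
have L0 : L != [::].
  have [e eE _] := EP o; apply/eqP => L0.
  by have := LP e e e eE eE eE; rewrite L0.
have [a _ aP] := seq_argmin
  (triple (@dist2 R X Y) g (work_function o rho)) L0.
exists a => -[[q1 q2] q3].
have [e1 e1E W1] := EP q1; have [e2 e2E W2] := EP q2.
have [e3 e3E W3] := EP q3.
apply: le_trans (aP _ (LP _ _ _ e1E e2E e3E)) _.
have := triple_proj dist2_pseudometric g0 g1 (lexx _) (lexx _) (lexx _)
  W1 W2 W3.
apply: le_trans; rewrite lerDl; apply: mulr_ge0; first exact: ltW.
by apply: addr_ge0; [apply: addr_ge0|]; exact: dist2_ge0.
Qed.

Lemma WFA_run_argmin (lambda : R) o rho ss : WFA_run lambda o rho ss ->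
  size ss = size rho /\ forall j, (j < size rho)%N ->
    argmin (fun t => work_function o (take j.+1 rho) t
                     + lambda * dist2 (nth o (o :: ss) j) t)
           (nth o (o :: ss) j.+1).
Proof.
elim=> [//|{}rho {}ss r s' _ [sz IH] s'P]; rewrite !size_rcons sz; split=> // j.
rewrite ltnS leq_eqVlt => /predU1P[->|jn].
  rewrite take_oversize ?size_rcons// -rcons_cons !nth_rcons/= sz.
  by rewrite ltnS leqnn ltnn eqxx -sz -last_nth.
rewrite -rcons_cons !nth_rcons/= sz ltnS (ltnW jn) ltnS jn.
by rewrite -cats1 takel_cat//; exact: IH.
Qed.

Lemma path_cost_nth o ss : path_cost o ss =
  \sum_(j < size ss) dist2 (nth o (o :: ss) j) (nth o (o :: ss) j.+1).
Proof.
elim/last_ind: ss => [|ss s IH]; first by rewrite big_ord0.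
rewrite path_cost_rcons IH size_rcons big_ord_recr/= -rcons_cons.
congr (_ + _).
  apply: eq_bigr => -[j js] _ /=; rewrite -rcons_cons !nth_rcons/= js.
  by rewrite ltnS (ltnW js).
by rewrite !nth_rcons/= ltnS leqnn ltnn eqxx -last_nth.
Qed.

(** Comparing each move with staying put telescopes to [lambda] times the cost being at most
    [2 * spent delta n]; then [spent_bound] applies with [B] equal to the optimum. *)
Lemma WFA_cost (lambda g : R) o rho ss : 0 < lambda < 1 ->
  lambda = 1 - 2 * g -> WFA_run lambda o rho ss ->
  lambda * path_cost o ss
    <= 2 * (((g ^+ 4 / 800)^-1 * (8 / g) + 14 / g ^+ 2) * Opt o rho).
Proof.
move=> /andP[l0 l1] lg run.
have g0 : 0 < g by lra.
have g1 : 2 * g < 1 by lra.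
have l01 : 0 <= lambda < 1 by rewrite l1 ltW.
have ssS := WFA_run_serves l01 run.
have [sz argminP] := WFA_run_argmin run.
set n := size rho in sz argminP.
(* The origin acts as request 0, and [mkseq (nth o rho)] continues the sequence with requests at
   [o], so that the hypotheses on [W] hold at every index. *)
pose r j := nth o (o :: rho) j; pose s j := nth o (o :: ss) j.
pose W j := work_function o (mkseq (nth o rho) j).
have WE j : (j <= n)%N -> W j = work_function o (take j rho).
  by move=> jn; rewrite /W /mkseq map_nth_iota0.
have WS j : W j.+1 = work_function o (rcons (mkseq (nth o rho) j) (r j.+1)).
  by rewrite /W mkseqS.
have W_lip j : lipschitz1 (@dist2 R X Y) (W j).
  exact: work_function_lipschitz.
have W_succ j p : exists2 q, on_cross dist_fst dist_snd (r j.+1) q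
    & W j q + dist2 p q <= W j.+1 p.
  rewrite WS; have [q /request_setP qr Wq] :=
    work_function_rcons_ge o (mkseq (nth o rho) j) (r j.+1) p.
  by exists q.
have W_stay j q : on_cross dist_fst dist_snd (r j.+1) q -> W j.+1 q <= W j q.
  by move=> /request_setP; rewrite WS; exact: work_function_rcons_le.
have W_mono j p : W j p <= W j.+1 p.
  by have [q _ Wq] := W_succ j p; exact: le_trans (W_lip j p q) Wq.
have W_cross j p : exists2 q, on_cross dist_fst dist_snd (r j) q
    & W j q + dist2 p q <= W j p.
  case: j => [|j].
    exists o; first by left; rewrite /dist_fst mdistxx.
    by rewrite /W /= !work_function_nil dist2xx add0r dist2C.
  have [q qr Wq] := W_succ j p; exists q => //.
  by have := W_stay j q qr; lra.
have stepP j t : (j < n)%N -> W j.+1 (s j.+1) + lambda * dist2 (s j) (s j.+1)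
    <= W j.+1 t + lambda * dist2 (s j) t.
  by move=> jn; rewrite WE//; exact: argminP.
have s_slack j : (j <= n)%N -> slack (@dist2 R X Y) g (W j) (s j).
  case: j => [_|j jn] t; rewrite -lg.
    rewrite /W /s /= !work_function_nil dist2xx addr_ge0 ?dist2_ge0//.
    by rewrite mulr_ge0 ?dist2_ge0// ltW.
  have := stepP j t jn.
  have := ler_wpM2l (ltW l0) (dist2_triangle (s j.+1) (s j) t).
  by lra.
have s_cross j : (j <= n)%N -> on_cross dist_fst dist_snd (r j) (s j).
  case: j => [_|j jn]; first by left; rewrite /dist_fst mdistxx.
  apply/request_setP; rewrite /r /s /=.
  move: jn; rewrite /n; elim: (rho) (ss) j ssS {run sz argminP} => // q rho' IH.
  by case=> // t ss' [|j] /= [qt /IH {}IH]// jn; exact: IH.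
pose delta j := Num.min (dist_fst (s j) (r j.+1)) (dist_snd (s j) (r j.+1)).
have delta_ge0 j : 0 <= delta j by rewrite le_min !mdist_ge0.
(* The detour from [s j] moves the server closer to the request onto it and back, at cost [delta j]
   each way. *)
have ext j : (j < n)%N -> W j.+1 (s j) <= W j (s j) + 2 * delta j.
  have near q : dist2 (s j) q <= delta j ->
      on_cross dist_fst dist_snd (r j.+1) q ->
      W j.+1 (s j) <= W j (s j) + 2 * delta j.
    move=> sq qr; have := W_stay j q qr; have := W_lip j.+1 (s j) q.
    by have := W_lip j q (s j); rewrite (dist2C q); lra.
  move=> _; have [le|/ltW le] :=
      leP (dist_fst (s j) (r j.+1)) (dist_snd (s j) (r j.+1)).
    apply: (near ((r j.+1).1, (s j).2)).
      by rewrite /dist2 /= mdistxx addr0 le_min lexx le.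
    by left; rewrite /dist_fst mdistxx.
  apply: (near ((s j).1, (r j.+1).2)).
    by rewrite /dist2 /= mdistxx add0r le_min lexx le.
  by right; rewrite /dist_snd mdistxx.
have tele j : (j <= n)%N ->
    lambda * (\sum_(i < j) dist2 (s i) (s i.+1)) + W j (s j)
      <= 2 * spent delta j.
  elim: j => [_|j IH jn].
    by rewrite big_ord0 spent0 !mulr0 add0r /W work_function_nil dist2xx.
  have := IH (ltnW jn); have := stepP j (s j) jn; have := ext j jn.
  by rewrite big_ord_recr/= dist2xx spentS; lra.
have [ssO ssOS [OE _]] := Opt_attained o rho.
(* The cheap final point is the endpoint of an optimal schedule. *)
have zB : W n (last o ssO) <= Opt o rho.
  rewrite WE// take_size OE.
  have [ss' _ [-> /(_ _ ssOS)]] :=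
    work_function_attained o rho (last o ssO).
  by rewrite (path_cost_rcons o ssO) dist2xx addr0.
have [Phi PhiP] :=
  choice (fun j => triple_attained o (mkseq (nth o rho) j) g0 g1).
have W_ge0 : 0 <= W n (s n).
  exact: le_trans (dist2_ge0 o _) (dist2_work_function _ _ _).
have := tele n (leqnn n); rewrite path_cost_nth sz => cost.
have : lambda * (\sum_(j < n) dist2 (s j) (s j.+1)) <= 2 * spent delta n.
  by lra.
move=> /le_trans; apply; apply: ler_wpM2l => //.
apply: (@spent_bound _ _ dist_fst dist_snd (@dist2 R X Y)
  dist_fst_pseudometric dist_snd_pseudometric _ _ g g0 g1 r W W_lip W_cross
  W_mono W_succ W_stay s n _ _ delta delta_ge0 _ _
  (fun j => triple (@dist2 R X Y) g (W j) (Phi j)) PhiP _ o (last o ssO))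
  => //.
- by move=> p q; exists (p.1, q.2); rewrite /dist_fst /dist_snd !mdistxx.
- by move=> j /ltnW; exact: s_slack.
- by move=> j /ltnW; exact: s_cross.
- by move=> j _; rewrite ge_min lexx.
- by move=> j _; rewrite ge_min lexx orbT.
- by move=> j; exists (Phi j).
- by move=> j p; exact: dist2_work_function.
Qed.

End WorkFunction.

Theorem theorem2 (R : realType) (lambda : R) (lambda01 : 0 < lambda < 1) :
  exists c c0 : R, 1 <= c /\
    forall (X Y : metricType R) (o : X * Y) (rho ss : seq (X * Y)),
      WFA_run lambda o rho ss ->
      path_cost o ss <= c * Opt o rho + c0.
Proof.
have /andP[l0 l1] := lambda01.
pose g := (1 - lambda) / 2; have lg : lambda = 1 - 2 * g by rewrite /g; lra.
pose C := 2 / lambda * ((g ^+ 4 / 800)^-1 * (8 / g) + 14 / g ^+ 2).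
(* The maximum only ensures [1 <= c]; the bound by [C] needs no additive constant. *)
exists (Num.max 1 C), 0; split; first by rewrite le_max lexx.
move=> X Y o rho ss run; rewrite addr0.
have Opt_ge0 : 0 <= Opt o rho.
  by have [ssO _ [-> _]] := Opt_attained o rho; exact: path_cost_ge0.
apply: (@le_trans _ _ (C * Opt o rho)); last first.
  by apply: ler_wpM2r => //; rewrite le_max lexx orbT.
rewrite -(ler_pM2l l0); apply: le_trans (WFA_cost lambda01 lg run) _.
rewrite /C; move: ((g ^+ 4 / 800)^-1 * _ + _) (Opt o rho) => K w.
by have -> : lambda * (2 / lambda * K * w) = 2 * (K * w);
  [field; rewrite gt_eqF|].
Qed.
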